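(* Let $K$ be a loop with identity $\epsilon$, $G$ a group with identity $e$, and let $K\times_f^{\Theta}G$ and $K\times_{f'}^{\Theta'}G$ be Schreier extensions. (A) $K\times_{f'}^{\Theta'}G$ is equivalent to $K\times_f^{\Theta}G$ if and only if there is a function $n:K\to G$ with $n(\epsilon)=e$ such that for all $\sigma,\tau\in K$ $$\Theta'_\sigma=\iota_{n(\sigma)}^{-1}\circ\Theta_\sigma\quad\text{and}\quad f'(\sigma,\tau)=n(\sigma\tau)^{-1}f(\sigma,\tau)\,\Theta_\tau(n(\sigma))\,n(\tau).$$ (B) $K\times_{f'}^{\Theta'}G$ is equivalent in a wider sense to $K\times_f^{\Theta}G$ if and only if there are a function $n:K\to G$ with $n(\epsilon)=e$ and an automorphism $\mu\in\mathrm{Aut}(K)$ such that for all $\sigma,\tau\in K$ $$\Theta'_\sigma=\iota_{n(\mu(\sigma))}^{-1}\circ\Theta_{\mu(\sigma)}\quad\text{and}\quad f'(\sigma,\tau)=n(\mu(\sigma\tau))^{-1}f(\mu(\sigma),\mu(\tau))\,\Theta_{\mu(\tau)}\big(n(\mu(\sigma))\big)\,n(\mu(\tau)).$$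
   Context: For maps $f:K\times K\to G$ and $\Theta:K\to\mathrm{Aut}(G)$ with $f(\sigma,\epsilon)=f(\epsilon,\sigma)=e$ for all $\sigma$ and $\Theta_\epsilon=\mathrm{Id}$, the Schreier extension $K\times_f^{\Theta}G$ is the loop on $K\times G$ with multiplication $(\sigma,s)(\tau,t)=(\sigma\tau,f(\sigma,\tau)\Theta_\tau(s)t)$. For $r,t\in G$, $\iota_r(t)=rtr^{-1}$. A loop $L$ is an extension of $G$ by $K$ if $G$ is a normal subloop of $L$ and $L/G\cong K$. $K\times_f^{\Theta}G$ is a Schreier decomposition of $L$ (with respect to $G$) if there is an isomorphism $\mathcal{F}:K\times_f^{\Theta}G\to L$ with $\mathcal{F}(\epsilon,t)=t$ for all $t\in G$; the isomorphism $K\to L/G$, $\sigma\mapsto\mathcal{F}(\sigma,e)G$, is its underlying isomorphism. Two Schreier extensions $K\times_f^{\Theta}G$ and $K\times_{f'}^{\Theta'}G$ are equivalent in a wider sense if there is an extension $L$ of $G$ by $K$ such that both are Schreier decompositions of $L$; they are equivalent if there is an extension $L$ of $G$ by $K$ such that both are Schreier decompositions of $L$ with respect to $G$ with the same underlying isomorphism $K\to L/G$. *)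

(* Defs.v *)
From HB Require Import structures.
From mathcomp Require Import all_boot.
From mathcomp Require Import boolp classical_sets.

Set Implicit Arguments.
Unset Strict Implicit.
Unset Printing Implicit Defensive.

Local Open Scope classical_set_scope.
Local Open Scope group_scope.

HB.mixin Record UMagma_isLoop L of UMagma L := {
  ldiv_unique : forall a b : L, exists! x : L, a * x = b;
  rdiv_unique : forall a b : L, exists! y : L, y * a = b
}.

#[short(type="loopType")]
HB.structure Definition Loop := {L of UMagma_isLoop L & UMagma L}.

Section LoopTheory.
Variable L : loopType.
Implicit Types a b x y : L.

Lemma mulgL_inj a : injective (fun x => a * x).
Proof.
move=> x y /= e; have [z [_ u]] := ldiv_unique a (a * y).
by rewrite -(u x e) -(u y erefl).
Qed.

Lemma mulgR_inj a : injective (fun x => x * a).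
Proof.
move=> x y /= e; have [z [_ u]] := rdiv_unique a (y * a).
by rewrite -(u x e) -(u y erefl).
Qed.

End LoopTheory.

(* Aut(A); the inverse map is part of the data. *)
Record automorphism (A : magmaType) := Automorphism {
  aut_fun :> {multiplicative A -> A};
  aut_inv : A -> A;
  aut_funK : cancel aut_fun aut_inv;
  aut_invK : cancel aut_inv aut_fun
}.

Section Inner.
Variables (G : groupType) (r : G).

(* Note that x ^ y in the library is y^-1 * x * y, hence not used here. *)
Definition inner_fun (t : G) : G := r * t * r^-1.

Lemma inner_funM : {morph inner_fun : x y / x * y}.
Proof. by move=> x y; rewrite /inner_fun !mulgA mulgVK. Qed.

HB.instance Definition _ := isMultiplicative.Build G G inner_fun inner_funM.

Lemma inner_funK : cancel inner_fun (fun t => r^-1 * t * r).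
Proof. by move=> t; rewrite /inner_fun !mulgA mulVg mul1g mulgVK. Qed.

Lemma inner_funVK : cancel (fun t => r^-1 * t * r) inner_fun.
Proof. by move=> t; rewrite /inner_fun !mulgA mulgV mul1g mulgK. Qed.

Definition inner : automorphism G :=
  @Automorphism G inner_fun _ inner_funK inner_funVK.

End Inner.

Definition factor_system (K : loopType) (G : groupType)
    (f : K -> K -> G) (Theta : K -> automorphism G) : Prop :=
  (forall sigma : K, f sigma 1 = 1 /\ f 1 sigma = 1) /\
  (forall s : G, Theta 1 s = s).

(* The carrier is renamed because K * G already carries the direct product. *)
Definition schreier_ext (K : loopType) (G : groupType) (f : K -> K -> G)
    (Theta : K -> automorphism G) (fT : factor_system f Theta) : Type :=
  (K * G)%type.

Section SchreierLoop.
Variables (K : loopType) (G : groupType) (f : K -> K -> G).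
Variables (Theta : K -> automorphism G) (fT : factor_system f Theta).
Local Notation S := (schreier_ext fT).

Definition schreier_mul (x y : S) : S :=
  (x.1 * y.1, f x.1 y.1 * Theta y.1 x.2 * y.2).

Definition schreier_one : S := (1, 1).

HB.instance Definition _ := Choice.copy S (K * G)%type.
HB.instance Definition _ := hasMul.Build S schreier_mul.

Lemma schreier_mul1g : left_id schreier_one schreier_mul.
Proof.
case=> t s; rewrite /schreier_mul /= mul1g (fT.1 t).2 mul1g.
suff -> : Theta t 1 = 1 by rewrite mul1g.
by apply: (mulgI (Theta t 1)); rewrite -gmulfM !mulg1.
Qed.

Lemma schreier_mulg1 : right_id schreier_one schreier_mul.
Proof.
by case=> t s; rewrite /schreier_mul /= !mulg1 (fT.1 t).1 mul1g fT.2.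
Qed.

HB.instance Definition _ :=
  Magma_isUMagma.Build S schreier_mul1g schreier_mulg1.

Lemma schreier_ldiv (a b : S) : exists! x : S, a * x = b.
Proof.
case: a b => [a s] [b t]; have [c [cE cu]] := ldiv_unique a b.
exists (c, (f a c * Theta c s)^-1 * t); split=> [|[d u]].
  by rewrite /mul /= /schreier_mul /= cE mulVKg.
move=> e; move: (congr1 fst e) (congr1 snd e) => /= /cu -> <-.
by rewrite mulKg.
Qed.

Lemma schreier_rdiv (a b : S) : exists! y : S, y * a = b.
Proof.
case: a b => [a s] [b t]; have [c [cE cu]] := rdiv_unique a b.
exists (c, aut_inv (Theta a) ((f c a)^-1 * (t * s^-1))); split=> [|[d u]].
  by rewrite /mul /= /schreier_mul /= cE aut_invK mulVKg mulgVK.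
move=> e; move: (congr1 fst e) (congr1 snd e) => /= /cu -> <-.
by rewrite mulgK mulKg aut_funK.
Qed.

HB.instance Definition _ := UMagma_isLoop.Build S schreier_ldiv schreier_rdiv.

End SchreierLoop.

Section Normal.
Variable L : loopType.

Definition lcoset (x : L) (N : set L) : set L := [set x * n | n in N].
Definition rcoset (N : set L) (x : L) : set L := [set n * x | n in N].

Definition subloop (N : set L) : Prop :=
  [/\ N 1,
      forall a b, N a -> N b -> N (a * b),
      forall a x, N a -> N (a * x) -> N x &
      forall a y, N a -> N (y * a) -> N y].

(* xN = Nx, x(yN) = (xy)N and (Nx)y = N(xy) for all x, y in L. *)
Definition normal_subloop (N : set L) : Prop :=
  [/\ subloop N,
      forall x, lcoset x N = rcoset N x,
      forall x y, lcoset x (lcoset y N) = lcoset (x * y) N &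
      forall x y, rcoset (rcoset N x) y = rcoset N (x * y)].

Definition is_lcoset (N A : set L) : Prop := exists x, A = lcoset x N.

Definition loop_quotient (N : set L) (nN : normal_subloop N) : Type :=
  {A : set L | `[< is_lcoset N A >]}.

End Normal.

Section Quotient.
Variables (L : loopType) (N : set L) (nN : normal_subloop N).
Local Notation Q := (loop_quotient nN).

HB.instance Definition _ := SubType.on Q.
HB.instance Definition _ := Choice.on Q.

Lemma lcosetP x : `[< is_lcoset N (lcoset x N) >].
Proof. by apply/asboolP; exists x. Qed.

Definition coset (x : L) : Q := exist _ (lcoset x N) (lcosetP x).

Lemma coset_surj (A : Q) : exists x, A = coset x.
Proof.
by case: A => A AP; have /asboolP[x Ax] := AP; exists x; apply: val_inj.
Qed.

Lemma mem_lcoset x : lcoset x N x.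
Proof. by case: nN => -[N1 _ _ _] _ _ _; exists 1 => //; rewrite mulg1. Qed.

Lemma lcoset_mulr x n : N n -> lcoset (x * n) N = lcoset x N.
Proof.
case: nN => -[N1 NM NL _] _ Nl _ Nn; rewrite -Nl.
suff -> : lcoset n N = N by [].
apply/seteqP; split=> [_ [m Nm <-]|m Nm]; first exact: NM.
have [z [zE _]] := ldiv_unique n m.
by exists z => //; apply: (NL n) => //; rewrite zE.
Qed.

Lemma lcoset_eq x y : lcoset y N x -> lcoset x N = lcoset y N.
Proof. by case=> n Nn <-; apply: lcoset_mulr. Qed.

Lemma coset_eqP x y : coset x = coset y <-> exists2 n, N n & x = y * n.
Proof.
split=> [[e]|[n Nn ->]]; last by apply: val_inj; rewrite /= lcoset_mulr.
by have := mem_lcoset x; rewrite e => -[n Nn <-]; exists n.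
Qed.

Lemma lcosetM x y :
  [set a * b | a in lcoset x N & b in lcoset y N] = lcoset (x * y) N.
Proof.
have [_ Nlr Nl Nr] := nN; apply/seteqP; split.
  move=> _ [a xa [b yb <-]].
  have ay : lcoset (x * y) N (a * y).
    rewrite Nlr -Nr -Nlr; case: xa => n Nn <-.
    by exists (x * n) => //; exists n.
  by rewrite -(lcoset_eq ay) -Nl; exists b.
rewrite -Nl => _ [b yb <-]; exists x; first exact: mem_lcoset.
by exists b.
Qed.

(* The product of two cosets is their complex product. *)
Lemma quotient_mulP (A B : Q) :
  `[< is_lcoset N [set a * b | a in val A & b in val B] >].
Proof.
have [x ->] := coset_surj A; have [y ->] := coset_surj B.
by apply/asboolP; exists (x * y); rewrite /= lcosetM.
Qed.

Definition quotient_mul (A B : Q) : Q :=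
  exist _ [set a * b | a in val A & b in val B] (quotient_mulP A B).

HB.instance Definition _ := hasMul.Build Q quotient_mul.

Lemma cosetM : {morph coset : x y / x * y}.
Proof. by move=> x y; apply: val_inj; rewrite /= lcosetM. Qed.

HB.instance Definition _ := isMultiplicative.Build L Q coset cosetM.

Lemma quotient_mul1g : left_id (coset 1) quotient_mul.
Proof.
move=> A; have [x ->] := coset_surj A.
by rewrite -[RHS](congr1 coset (mul1g x)) cosetM.
Qed.

Lemma quotient_mulg1 : right_id (coset 1) quotient_mul.
Proof.
move=> A; have [x ->] := coset_surj A.
by rewrite -[RHS](congr1 coset (mulg1 x)) cosetM.
Qed.

HB.instance Definition _ :=
  Magma_isUMagma.Build Q quotient_mul1g quotient_mulg1.

Lemma quotient_ldiv (A B : Q) : exists! X : Q, A * X = B.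
Proof.
have [a ->] := coset_surj A; have [b ->] := coset_surj B.
have [x [xE _]] := ldiv_unique a b.
exists (coset x); split=> [|X]; first by rewrite -cosetM xE.
have [y ->] := coset_surj X; rewrite -cosetM -xE => -[e].
have [_ _ Nl _] := nN; have := mem_lcoset (a * y).
rewrite e -Nl => -[z xz /mulgL_inj zy].
by apply: val_inj; rewrite /= -(lcoset_eq xz) zy.
Qed.

Lemma quotient_rdiv (A B : Q) : exists! Y : Q, Y * A = B.
Proof.
have [a ->] := coset_surj A; have [b ->] := coset_surj B.
have [x [xE _]] := rdiv_unique a b.
exists (coset x); split=> [|X]; first by rewrite -cosetM xE.
have [y ->] := coset_surj X; rewrite -cosetM -xE => -[e].
have [_ Nlr _ Nr] := nN; have := mem_lcoset (y * a).
rewrite e Nlr -Nr -Nlr => -[z xz /mulgR_inj zy].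
by apply: val_inj; rewrite /= -(lcoset_eq xz) zy.
Qed.

HB.instance Definition _ := UMagma_isLoop.Build Q quotient_ldiv quotient_rdiv.

End Quotient.

(* An extension of G by K. The inclusion of the normal subloop G in L is an
   injective homomorphism, which identifies t : G with ext_incl t. *)
Record extension (K : loopType) (G : groupType) := Extension {
  ext_loop : loopType;
  ext_incl : {multiplicative G -> ext_loop};
  ext_incl_inj : injective ext_incl;
  ext_normal : normal_subloop (range ext_incl);
  ext_quotient :
    exists phi : {multiplicative K -> loop_quotient ext_normal}, bijective phi
}.

Section Equivalence.
Variables (K : loopType) (G : groupType).

Definition schreier_decomposition (f : K -> K -> G)
    (Theta : K -> automorphism G) (fT : factor_system f Theta)
    (E : extension K G)
    (F : {multiplicative schreier_ext fT -> ext_loop E}) : Prop :=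
  bijective F /\ forall t : G, F (1, t) = ext_incl E t.

Definition underlying_iso (f : K -> K -> G)
    (Theta : K -> automorphism G) (fT : factor_system f Theta)
    (E : extension K G)
    (F : {multiplicative schreier_ext fT -> ext_loop E}) :
    K -> loop_quotient (ext_normal E) :=
  fun sigma => coset (ext_normal E) (F (sigma, 1)).

Variables (f : K -> K -> G) (Theta : K -> automorphism G).
Variables (f' : K -> K -> G) (Theta' : K -> automorphism G).
Variables (fT : factor_system f Theta) (fT' : factor_system f' Theta').

Definition equivalent_wider : Prop :=
  exists (E : extension K G)
    (F : {multiplicative schreier_ext fT -> ext_loop E})
    (F' : {multiplicative schreier_ext fT' -> ext_loop E}),
    schreier_decomposition F /\ schreier_decomposition F'.

Definition equivalent : Prop :=
  exists (E : extension K G)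
    (F : {multiplicative schreier_ext fT -> ext_loop E})
    (F' : {multiplicative schreier_ext fT' -> ext_loop E}),
    [/\ schreier_decomposition F, schreier_decomposition F' &
        underlying_iso F =1 underlying_iso F'].

End Equivalence.

(* Main.v *)
Require Import Defs.
From HB Require Import structures.
From mathcomp Require Import all_boot.
From mathcomp Require Import boolp classical_sets.

(** Two Schreier decompositions F, F' of the same loop differ by an isomorphism
    of Schreier extensions fixing every (1, t).  Such a map is determined by its
    values (mu sigma, n (mu sigma)) at (sigma, 1).  Applied to the products
    (sigma, 1)(tau, 1) and (1, s)(tau, 1), multiplicativity gives the formulas
    for f' and Theta'.  Conversely, under these formulas
    (sigma, s) |-> (mu sigma, n (mu sigma) s) is an isomorphism of Schreier
    extensions.  It preserves the cosets of G exactly when mu is the identity. *)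

Set Implicit Arguments.
Unset Strict Implicit.
Unset Printing Implicit Defensive.

Local Open Scope group_scope.

Lemma multiplicative1 (G H : groupType) (h : {multiplicative G -> H}) : h 1 = 1.
Proof. by apply: (mulgI (h 1)); rewrite -gmulfM !mulg1. Qed.

(** * A Schreier extension as an extension of [G] by [K] *)

Section SchreierTheory.
Variables (K : loopType) (G : groupType) (f : K -> K -> G).
Variables (Theta : K -> automorphism G) (fT : factor_system f Theta).
Local Notation S := (schreier_ext fT).

Lemma schreier_mulE (x y : S) :
  x * y = (x.1 * y.1, f x.1 y.1 * Theta y.1 x.2 * y.2).
Proof. by []. Qed.

Lemma schreier_mul_in (sigma : K) (s t : G) :
  ((sigma, s) : S) * ((1, t) : S) = (sigma, s * t).
Proof. by rewrite schreier_mulE /= mulg1 (fT.1 sigma).1 mul1g fT.2. Qed.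

Lemma schreier_in_mul (tau : K) (s t : G) :
  ((1, s) : S) * ((tau, t) : S) = (tau, Theta tau s * t).
Proof. by rewrite schreier_mulE /= mul1g (fT.1 tau).2 mul1g. Qed.

Lemma schreier_mul_sections (sigma tau : K) :
  ((sigma, 1) : S) * ((tau, 1) : S) = (sigma * tau, f sigma tau).
Proof. by rewrite schreier_mulE /= multiplicative1 !mulg1. Qed.

Definition schreier_incl (t : G) : S := (1, t).

Lemma schreier_inclM : {morph schreier_incl : s t / s * t}.
Proof. by move=> s t; rewrite /schreier_incl schreier_mul_in. Qed.

HB.instance Definition _ :=
  isMultiplicative.Build G S schreier_incl schreier_inclM.

Lemma schreier_incl_inj : injective schreier_incl.
Proof. by move=> s t []. Qed.

Local Open Scope classical_set_scope.
Local Notation N := (range schreier_incl).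

(** Right multiplication by [(1, t)] only translates the second coordinate by [t]. Once cosets are
    fibres of the first projection, normality reduces to the loop laws of [K]. *)
Lemma schreier_lcosetE (x : S) : lcoset x N = [set y | y.1 = x.1].
Proof.
case: x => sigma s; apply/seteqP; split=> [_ [_ [t _ <-] <-]|[tau t] /= ->].
  by rewrite schreier_mul_in.
exists (schreier_incl (s^-1 * t)); first by exists (s^-1 * t).
by rewrite schreier_mul_in mulVKg.
Qed.

Lemma schreier_rcosetE (x : S) : rcoset N x = [set y | y.1 = x.1].
Proof.
case: x => sigma s; apply/seteqP; split=> [_ [_ [t _ <-] <-]|[tau t] /= ->].
  by rewrite schreier_in_mul.
(* [u] solves [Theta sigma u * s = t]: surjectivity of [Theta sigma] makes right cosets fill the
   same fibres. *)
pose u := aut_inv (Theta sigma) (t * s^-1).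
exists (schreier_incl u); first by exists u.
by rewrite schreier_in_mul aut_invK mulgVK.
Qed.

Lemma schreier_in_range (x : S) : N x <-> x.1 = 1.
Proof.
by split=> [[t _ <-] //|]; case: x => sigma s /= ->; exists s.
Qed.

Lemma schreier_normal : normal_subloop N.
Proof.
split=> [|x|x y|x y].
- split=> [|a b|a x|a y]; rewrite ?schreier_in_range /=.
  + by [].
  + by move=> -> ->; rewrite mul1g.
  + by move=> ->; rewrite mul1g.
  + by move=> ->; rewrite mulg1.
- by rewrite schreier_lcosetE schreier_rcosetE.
- rewrite !schreier_lcosetE; apply/seteqP; split=> [_ [z /= zy <-]|z /= zxy].
    by rewrite /= zy.
  have [w [wE _]] := ldiv_unique x z.
  exists w => //=; apply: (@mulgL_inj _ x.1).
  by rewrite -[LHS]/((x * w).1) wE.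
- rewrite !schreier_rcosetE; apply/seteqP; split=> [_ [z /= zx <-]|z /= zxy].
    by rewrite /= zx.
  have [w [wE _]] := rdiv_unique y z.
  exists w => //=; apply: (@mulgR_inj _ y.1).
  by rewrite -[LHS]/((w * y).1) wE.
Qed.

Definition schreier_section (sigma : K) : loop_quotient schreier_normal :=
  coset schreier_normal (sigma, 1).

Lemma schreier_coset_eqP (x y : S) :
  coset schreier_normal x = coset schreier_normal y <-> x.1 = y.1.
Proof.
split=> [/(congr1 val) /= e|e].
  by have := mem_lcoset schreier_normal x; rewrite e schreier_lcosetE.
by apply: val_inj; rewrite /= !schreier_lcosetE e.
Qed.

Lemma schreier_sectionM : {morph schreier_section : x y / x * y}.
Proof.
move=> x y; rewrite /schreier_section -cosetM.
by apply/schreier_coset_eqP.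
Qed.

HB.instance Definition _ := isMultiplicative.Build K
  (loop_quotient schreier_normal) schreier_section schreier_sectionM.

Lemma schreier_section_bij : bijective schreier_section.
Proof.
(* The representative is chosen arbitrarily, but its first coordinate depends only on the coset. *)
pose rep A := (projT1 (cid (coset_surj (nN := schreier_normal) A))).1.
have repE A : schreier_section (rep A) = A.
  rewrite /rep; case: cid => x /= ->.
  by apply/schreier_coset_eqP.
exists rep => // sigma.
by have /schreier_coset_eqP := repE (schreier_section sigma).
Qed.

Lemma schreier_quotient :
  exists phi : {multiplicative K -> loop_quotient schreier_normal},
    bijective phi.
Proof. by exists schreier_section; apply: schreier_section_bij. Qed.

Definition schreier_extension : extension K G :=
  Extension schreier_incl_inj schreier_quotient.

Lemma schreier_decomposition_id :
  schreier_decomposition (E := schreier_extension)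
    (idfun : {multiplicative S -> S}).
Proof. by split; first by exists id. Qed.

End SchreierTheory.

(** * Cosets seen through one Schreier decomposition *)

Section Decomposition.
Variables (K : loopType) (G : groupType) (f : K -> K -> G).
Variables (Theta : K -> automorphism G) (fT : factor_system f Theta).
Variables (E : extension K G).
Variable F : {multiplicative schreier_ext fT -> ext_loop E}.
Hypothesis FP : schreier_decomposition F.

Lemma decompositionE (sigma : K) (s t : G) :
  F (sigma, s * t) = F (sigma, s) * ext_incl E t.
Proof. by rewrite -schreier_mul_in gmulfM FP.2. Qed.

Lemma decomposition_coset (sigma : K) (s : G) :
  coset (ext_normal E) (F (sigma, s)) = underlying_iso F sigma.
Proof.
apply/coset_eqP; exists (ext_incl E s); first by exists s.
by rewrite -decompositionE mul1g.
Qed.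

Lemma underlying_iso_inj : injective (underlying_iso F).
Proof.
move=> sigma tau /coset_eqP[_ [t _ <-]].
by rewrite -decompositionE => /(bij_inj FP.1)[].
Qed.

End Decomposition.

(** * Comparison of two Schreier extensions *)

Section TwoSystems.
Variables (K : loopType) (G : groupType).
Variables (f : K -> K -> G) (Theta : K -> automorphism G).
Variables (f' : K -> K -> G) (Theta' : K -> automorphism G).
Variables (fT : factor_system f Theta) (fT' : factor_system f' Theta').
Local Notation S := (schreier_ext fT).
Local Notation S' := (schreier_ext fT').

(** The condition of (B); that of (A) is the case where [mu] is the identity. *)
Definition related_by (n : K -> G) (mu : K -> K) : Prop :=
  forall sigma tau : K,
    Theta' sigma =1 aut_inv (inner (n (mu sigma))) \o Theta (mu sigma) /\
    f' sigma tau =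
      (n (mu (sigma * tau)))^-1 * f (mu sigma) (mu tau)
        * Theta (mu tau) (n (mu sigma)) * n (mu tau).

Section FromDecompositions.
Variables (E : extension K G).
Variable F' : {multiplicative S' -> ext_loop E}.
Variable F : {multiplicative S -> ext_loop E}.
Hypotheses (FP' : schreier_decomposition F') (FP : schreier_decomposition F).

Lemma related_of_decompositions :
  exists (n : K -> G) (mu : automorphism K),
    [/\ n 1 = 1, related_by n mu &
        underlying_iso F' =1 underlying_iso F \o mu].
Proof.
have [Fi FK FiK] := FP.1; have [Fi' FK' FiK'] := FP'.1.
(* [mu] and [m] are the coordinates of the transition map [Fi \o F'] on the section; [m sigma] will
   be [n (mu sigma)]. *)
pose mu sigma := (Fi (F' (sigma, 1))).1.
pose m sigma := (Fi (F' (sigma, 1))).2.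
have FE sigma s : F' (sigma, s) = F (mu sigma, m sigma * s).
  rewrite (decompositionE FP) -{1}[s]mul1g (decompositionE FP').
  by rewrite -surjective_pairing FiK.
have muM : {morph mu : x y / x * y}.
  move=> x y; have := @gmulfM _ _ F' (x, 1) (y, 1).
  by rewrite schreier_mul_sections !FE -gmulfM => /(can_inj FK)[].
pose nu sigma := (Fi' (F (sigma, 1))).1.
have muK : cancel mu nu.
  (* By [FE], [F (mu sigma, 1)] is [F' (sigma, (m sigma)^-1)], whose first coordinate under [Fi'] is
     [sigma]. *)
  move=> sigma; rewrite /nu -[1](mulgV (m sigma)) -FE.
  by rewrite FK'.
have nuK : cancel nu mu.
  move=> sigma; have := FiK' (F (sigma, 1)).
  by rewrite [Fi' _]surjective_pairing FE => /(can_inj FK)[].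
pose muX := isMultiplicative.Build K K mu muM.
pose muH : {multiplicative K -> K} := HB.pack mu muX.
(* The formulas evaluate [n] at [mu sigma], so [m] is reindexed by the inverse [nu] of [mu]. *)
exists (m \o nu), (@Automorphism K muH nu muK nuK); split.
- have m1 : F' (1, 1) = F (1, 1) by rewrite FP.2 FP'.2.
  have /(can_inj FK)[e _] : F (mu 1, m 1 * 1) = F (1, 1) by rewrite -FE.
  by rewrite /= -{1}e muK /m m1 FK.
- move=> sigma tau; rewrite /= !muK; split=> [s|].
    (* Second coordinates give [m sigma * Theta' sigma s = Theta (mu sigma) s * m sigma]. *)
    have := @gmulfM _ _ F' (1, s) (sigma, 1).
    rewrite schreier_in_mul FP'.2 -FP.2 !FE -gmulfM schreier_in_mul !mulg1.
    by move=> /(can_inj FK)[e]; rewrite /= -mulgA -e mulKg.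
  have := @gmulfM _ _ F' (sigma, 1) (tau, 1).
  rewrite schreier_mul_sections !FE -gmulfM !mulg1 => /(can_inj FK)[_ e].
  by rewrite -!mulgA [X in _ * X]mulgA -e mulKg.
- by move=> sigma; rewrite /= -(decomposition_coset FP _ (m sigma * 1)) -FE.
Qed.

End FromDecompositions.

Section ToDecompositions.
Variables (n : K -> G) (mu : automorphism K).
Hypotheses (n1 : n 1 = 1) (nmu : related_by n mu).

Definition related_map (x : S') : S := (mu x.1, n (mu x.1) * x.2).

Lemma related_mapM : {morph related_map : x y / x * y}.
Proof.
move=> [sigma s] [tau t]; rewrite /related_map !schreier_mulE /= gmulfM.
(* The formula for [Theta'] involves only the first index, so the second [tau] is arbitrary. The
   factor [n (mu tau)] ending [f'] cancels against the inverse opening the conjugation. *)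
congr (_, _); have [_ ->] := nmu sigma tau; rewrite (nmu tau tau).1 /=.
by rewrite !gmulfM !mulgA mulgV mul1g mulgK.
Qed.

HB.instance Definition _ := isMultiplicative.Build S' S related_map related_mapM.

Lemma related_map_bij : bijective related_map.
Proof.
exists (fun x : S => (aut_inv mu x.1, (n x.1)^-1 * x.2) : S') => -[sigma s].
  by rewrite /related_map /= aut_funK mulKg.
by rewrite /related_map /= aut_invK mulVKg.
Qed.

Lemma automorphism_loop1 : mu 1 = 1.
Proof. by apply: (@mulgL_inj _ (mu 1)); rewrite /= -gmulfM !mulg1. Qed.

Lemma decompositions_of_related :
  exists (E : extension K G) (F' : {multiplicative S' -> ext_loop E})
    (F : {multiplicative S -> ext_loop E}),
    [/\ schreier_decomposition F', schreier_decomposition F &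
        underlying_iso F' =1 underlying_iso F \o mu].
Proof.
(* The extension given by [f] and [Theta] itself serves as the common loop, decomposed by the
   identity and by [related_map]. *)
exists (schreier_extension fT), related_map, idfun; split.
- split=> [|t]; first exact: related_map_bij.
  by rewrite /= /related_map /= automorphism_loop1 n1 mul1g.
- exact: schreier_decomposition_id.
- by move=> sigma; apply/schreier_coset_eqP.
Qed.

End ToDecompositions.

End TwoSystems.

Definition automorphism_id (K : magmaType) : automorphism K :=
  @Automorphism K idfun idfun (fun _ => erefl) (fun _ => erefl).

Theorem theorem55 (K : loopType) (G : groupType)
    (f : K -> K -> G) (Theta : K -> automorphism G)
    (f' : K -> K -> G) (Theta' : K -> automorphism G)
    (fT : factor_system f Theta) (fT' : factor_system f' Theta') :
  (equivalent fT' fT <->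
   exists n : K -> G, n 1 = 1 /\
     forall sigma tau : K,
       Theta' sigma =1 aut_inv (inner (n sigma)) \o Theta sigma /\
       f' sigma tau =
         (n (sigma * tau))^-1 * f sigma tau * Theta tau (n sigma) * n tau)
  /\
  (equivalent_wider fT' fT <->
   exists (n : K -> G) (mu : automorphism K), n 1 = 1 /\
     forall sigma tau : K,
       Theta' sigma =1 aut_inv (inner (n (mu sigma))) \o Theta (mu sigma) /\
       f' sigma tau =
         (n (mu (sigma * tau)))^-1 * f (mu sigma) (mu tau)
           * Theta (mu tau) (n (mu sigma)) * n (mu tau)).
Proof.
split; split.
- move=> [E [F' [F [FP' FP FF]]]].
  have [n [mu [n1 nmu muE]]] := related_of_decompositions FP' FP.
  (* The underlying isomorphisms differ by [mu] and coincide, so injectivity forces [mu] to be the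
     identity. *)
  have mu_id sigma : mu sigma = sigma.
    by apply: (underlying_iso_inj FP); rewrite -[RHS]FF muE.
  by exists n; split=> // sigma tau; have := nmu sigma tau; rewrite !mu_id.
- move=> [n [n1 nP]].
  have [E [F' [F [FP' FP FF]]]] :=
    decompositions_of_related fT fT' (mu := automorphism_id K) n1 nP.
  by exists E, F', F.
- move=> [E [F' [F [FP' FP]]]].
  have [n [mu [n1 nmu _]]] := related_of_decompositions FP' FP.
  by exists n, mu.
- move=> [n [mu [n1 nmu]]].
  have [E [F' [F [FP' FP _]]]] := decompositions_of_related fT fT' n1 nmu.
  by exists E, F', F.
Qed.
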